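(* Let $n>0$ and let $\alpha$ be a composition of $n$. The Galois graph of $\mathrm{Tam}(\alpha)$ is isomorphic to the directed graph whose vertices are the join-irreducible elements of $\mathrm{Tam}(\alpha)$ and in which there exists a directed edge $w_{a,b}\to w_{a',b'}$ if and only if $w_{a,b}\neq w_{a',b'}$ and \begin{itemize} \item either $a$ and $a'$ belong to the same $\alpha$-region and $a\leq a'<b'\leq b$, \item or $a$ and $a'$ belong to different $\alpha$-regions and $a'<a<b'\leq b$, where $a$ and $b'$ belong to different $\alpha$-regions, too. \end{itemize}
   Context: Let $n>0$ and let $\alpha=(\alpha_1,\ldots,\alpha_r)$ be a composition of $n$ (a sequence of positive integers with sum $n$). Put $[n]=\{1,\ldots,n\}$, $p_0=0$ and $p_i=\alpha_1+\cdots+\alpha_i$. The $i$-th $\alpha$-region is $\{p_{i-1}+1,\ldots,p_i\}$. For $w$ in the symmetric group $\mathfrak{S}_n$ write $w_i=w(i)$, $\mathrm{Inv}(w)=\{(i,j): i<j,\ w_i>w_j\}$ and $\mathrm{Des}(w)=\{(i,j): i<j,\ w_i=w_j+1\}$ (the descents of $w$). The (left) weak order on $\mathfrak{S}_n$ is $u\leq_L v$ iff $\mathrm{Inv}(u)\subseteq\mathrm{Inv}(v)$. Let $\mathfrak{S}_\alpha$ be the set of $w\in\mathfrak{S}_n$ with $w_i<w_{i+1}$ for all $i\in[n-1]\setminus\{p_1,\ldots,p_{r-1}\}$. An $(\alpha,231)$-pattern in $w\in\mathfrak{S}_\alpha$ is a triple $(i,j,k)$ with $i<j<k$ all in different $\alpha$-regions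 such that $w_k<w_i<w_j$ and $w_i=w_k+1$. Let $\mathfrak{S}_\alpha(231)$ be the set of $w\in\mathfrak{S}_\alpha$ having no $(\alpha,231)$-pattern, and let $\mathrm{Tam}(\alpha)$ be the poset $(\mathfrak{S}_\alpha(231),\leq_L)$; it is a finite lattice. An $\alpha$-arc is a pair $(a,b)$ with $1\leq a<b\leq n$ and $a,b$ in different $\alpha$-regions. For each $\alpha$-arc $(a,b)$, $w_{a,b}$ denotes the unique join-irreducible element of $\mathrm{Tam}(\alpha)$ whose only descent is $(a,b)$; $(a,b)\mapsto w_{a,b}$ is a bijection from $\alpha$-arcs to join-irreducible elements of $\mathrm{Tam}(\alpha)$. Galois graph: a finite lattice $\mathbf{L}$ with maximum chain length $\ell(\mathbf{L})=N$ (length of a chain is its cardinality minus one) is extremal if it has exactly $N$ join-irreducible and exactly $N$ meet-irreducible elements. Fix a maximal chain $\hat0=a_0\lessdot a_1\lessdot\cdots\lessdot a_N=\hat1$ of length $N$. The join-irreducibles can be labeled $j_1,\ldots,j_N$ and the meet-irreducibles $m_1,\ldots,m_N$ such that $j_1\vee\cdots\vee j_s=a_s=m_{s+1}\wedge\cdots\wedge m_N$ for all $s$. The Galois graph of $\mathbf{L}$ is the directed graph with vertex set $\{1,\ldots,N\}$ in which $s\to t$ iff $s\neq t$ and $j_s\not\leq m_t$. The lattice $\mathrm{Tam}(\alpha)$ is extremal, so its Galois graph is defined. *)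

(* Defs.v *)
From HB Require Import structures.
From mathcomp Require Import all_boot all_order all_fingroup.

Set Implicit Arguments.
Unset Strict Implicit.
Unset Printing Implicit Defensive.

Import Order.TTheory.

Definition digraph_iso (V W : finType) (E : rel V) (F : rel W) : Prop :=
  exists2 f : V -> W, bijective f & forall s t, F (f s) (f t) = E s t.

(* Joins and meets are rendered as least upper and greatest lower bounds, so
   that the following notions make sense on any finite poset; on a finite
   lattice they are the usual ones. *)
Section Lattice.
Local Open Scope order_scope.
Variables (d : Order.disp_t) (L : finPOrderType d).
Implicit Types (x y z : L) (A : {set L}).

Definition is_lub A x : bool :=
  [forall z in A, z <= x] &&
  [forall y, [forall z in A, z <= y] ==> (x <= y)].

Definition is_glb A x : bool :=
  [forall z in A, x <= z] &&
  [forall y, [forall z in A, y <= z] ==> (y <= x)].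

Definition is_bottom x : bool := [forall y, x <= y].
Definition is_top x : bool := [forall y, y <= x].

Definition join_irreducible x : bool :=
  ~~ is_bottom x &&
  [forall y, forall z, is_lub [set y; z] x ==> ((x == y) || (x == z))].

Definition meet_irreducible x : bool :=
  ~~ is_top x &&
  [forall y, forall z, is_glb [set y; z] x ==> ((x == y) || (x == z))].

Definition covered_by x y : bool :=
  (x < y) && ~~ [exists z, (x < z) && (z < y)].

Definition is_chain A : bool := [forall x in A, forall y in A, x >=< y].

Definition poset_length : nat := (\max_(A : {set L} | is_chain A) #|A|.-1)%N.

(* The indices are shifted by one for j and m: [j i] and [m i] are the
   (i+1)-st irreducibles, so that a_s is the join of the [j i] with i < s and
   the meet of the [m i] with s <= i. Bijectivity of j and m onto the
   irreducibles says that L is extremal. *)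
Record galois_labeling (a : 'I_poset_length.+1 -> L)
    (j m : 'I_poset_length -> L) : Prop := GaloisLabeling {
  chain_bottom : is_bottom (a ord0);
  chain_top : is_top (a ord_max);
  chain_covers : forall s t : 'I_poset_length.+1,
    t = s.+1 :> nat -> covered_by (a s) (a t);
  j_injective : injective j;
  j_image : forall x, join_irreducible x <-> exists s, x = j s;
  m_injective : injective m;
  m_image : forall x, meet_irreducible x <-> exists s, x = m s;
  chain_joins : forall s : 'I_poset_length.+1,
    is_lub [set j i | i : 'I_poset_length & (i < s)%N] (a s);
  chain_meets : forall s : 'I_poset_length.+1,
    is_glb [set m i | i : 'I_poset_length & (s <= i)%N] (a s)
}.

Definition galois_graph (j m : 'I_poset_length -> L) : rel 'I_poset_length :=
  fun s t => (s != t) && ~~ (j s <= m t).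

End Lattice.

Definition is_composition (n : nat) (alpha : seq nat) : bool :=
  (sumn alpha == n) && all (leq 1) alpha.

Definition psum (alpha : seq nat) (k : nat) : nat := sumn (take k alpha).

(* Positions and values are 0-based, so the regions are the half-open
   intervals [p_k, p_(k+1)) with k < size alpha. *)
Definition in_region (alpha : seq nat) (k i : nat) : bool :=
  psum alpha k <= i < psum alpha k.+1.

Definition same_region (alpha : seq nat) (i i' : nat) : bool :=
  [exists k : 'I_(size alpha), in_region alpha k i && in_region alpha k i'].

Section Permutations.
Variable n : nat.
Implicit Types w : 'S_n.

Definition Inv w : {set 'I_n * 'I_n} :=
  [set p : 'I_n * 'I_n | (p.1 < p.2) && (w p.2 < w p.1)].

Definition Des w : {set 'I_n * 'I_n} :=
  [set p : 'I_n * 'I_n | (p.1 < p.2) && (w p.1 == (w p.2).+1 :> nat)].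

Definition weak_le (u v : 'S_n) : bool := Inv u \subset Inv v.

Lemma weak_le_refl : reflexive weak_le.
Proof. by move=> w; apply: subxx. Qed.

Lemma weak_le_trans : transitive weak_le.
Proof. by move=> v u w; apply: subset_trans. Qed.

Lemma card_perm_lt w (i : 'I_n) : #|[set k : 'I_n | w k < w i]| = w i.
Proof.
have -> : [set k : 'I_n | w k < w i] = w @^-1: [set k : 'I_n | k < w i].
  by apply/setP=> k; rewrite !inE.
rewrite card_preimset; last exact: perm_inj.
have le_wi : w i <= n by apply: ltnW.
have -> : [set k : 'I_n | k < w i] = [set widen_ord le_wi k | k : 'I_(w i)].
  apply/setP=> k; rewrite inE; apply/idP/imsetP => [lt_k | [k' _ ->]].
    by exists (Ordinal lt_k) => //; apply: val_inj.
  exact: (ltn_ord k').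
rewrite card_imset ?card_ord // => k k' /(congr1 val) /= eq_k.
exact: val_inj.
Qed.

Lemma Inv_inj : injective Inv.
Proof.
move=> u v eq_uv; apply/permP=> i; apply: val_inj.
rewrite /= -(card_perm_lt u i) -(card_perm_lt v i).
apply: eq_card => k; rewrite !inE.
case: (ltngtP k i) => [lt_ki | lt_ik | /val_inj ->]; last by rewrite !ltnn.
- have /setP/(_ (k, i)) := eq_uv; rewrite !inE /= lt_ki /= => eq_ki.
  have neq (w : 'S_n) : (w k < w i) = ~~ (w i < w k).
    rewrite -leqNgt ltn_neqAle; case: eqP => // /val_inj/perm_inj eqk.
    by move: lt_ki; rewrite eqk ltnn.
  by rewrite !neq eq_ki.
- by have /setP/(_ (i, k)) := eq_uv; rewrite !inE /= lt_ik.
Qed.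

Lemma weak_le_anti : antisymmetric weak_le.
Proof. by move=> u v uv_vu; apply/Inv_inj/eqP; rewrite eqEsubset. Qed.

Variable alpha : seq nat.

(* The 1-based position preceding the 0-based position j is the number j. *)
Definition S_alpha : {set 'S_n} :=
  [set w : 'S_n | [forall i : 'I_n, forall j : 'I_n,
    (j == i.+1 :> nat) &&
    (val j \notin [seq psum alpha k | k <- iota 1 (size alpha).-1])
    ==> (w i < w j)]].

Definition pattern231 w (i j k : 'I_n) : bool :=
  [&& i < j, j < k,
      ~~ same_region alpha i j, ~~ same_region alpha i k,
      ~~ same_region alpha j k,
      w k < w i, w i < w j & w i == (w k).+1 :> nat].

Definition S_alpha231 : {set 'S_n} :=
  [set w in S_alpha |
    ~~ [exists i, exists j, exists k, pattern231 w i j k]].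

Definition is_arc (a b : 'I_n) : bool := (a < b) && ~~ same_region alpha a b.

Record Tam : predArgType :=
  MkTam { tam_val :> 'S_n; tam_valP : tam_val \in S_alpha231 }.

HB.instance Definition _ := [isSub for tam_val].
HB.instance Definition _ := [Finite of Tam by <:].

Definition tam_le (u v : Tam) : bool := weak_le u v.

Lemma tam_le_refl : reflexive tam_le.
Proof. by move=> u; apply: weak_le_refl. Qed.

Lemma tam_le_anti : antisymmetric tam_le.
Proof. by move=> u v uv; apply/val_inj/weak_le_anti. Qed.

Lemma tam_le_trans : transitive tam_le.
Proof. by move=> v u w; apply: weak_le_trans. Qed.

End Permutations.

Fact tam_display : Order.disp_t. Proof. exact: Order.Disp tt tt. Qed.

HB.instance Definition _ (n : nat) (alpha : seq nat) :=
  Order.Le_isPOrder.Build tam_display (Tam n alpha)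
    (@tam_le_refl n alpha) (@tam_le_anti n alpha) (@tam_le_trans n alpha).

Definition tam_JI (n : nat) (alpha : seq nat) : finType :=
  {x : Tam n alpha | join_irreducible x}.

Definition arc_edge (n : nat) (alpha : seq nat) (a b a' b' : 'I_n) : bool :=
  (same_region alpha a a' && [&& a <= a', a' < b' & b' <= b])
  || [&& ~~ same_region alpha a a', a' < a, a < b', b' <= b
       & ~~ same_region alpha a b'].

(* The join-irreducible w_(a,b) is recognized by Des w_(a,b) = {(a,b)}. *)
Definition tam_digraph (n : nat) (alpha : seq nat) : rel (tam_JI n alpha) :=
  fun u u' => (u != u') &&
    [exists a, exists b, exists a', exists b',
      [&& is_arc alpha a b, is_arc alpha a' b',
          Des (val u) == [set (a, b)], Des (val u') == [set (a', b')]
        & arc_edge alpha a b a' b']].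
Arguments tam_digraph : clear implicits.

(* Main.v *)
Require Import Defs.
From mathcomp Require Import all_boot all_order all_fingroup.
From mathcomp Require Import zify.

Set Implicit Arguments.
Unset Strict Implicit.
Unset Printing Implicit Defensive.

Import Order.TTheory.

(** Write [w_(a,b)] for the element with descent set [{(a,b)}]. Its inversions
are the pairs [(i,k)] with [i] weakly right of [a] in the region of [a] and [k]
beyond that region but weakly left of [b]. Since elements of Tam increase along
regions, [w_(a,b) <= x] just says that [x k < x a] for all such [k]
([arc_join_leP]).

To each arc [(a,b)] corresponds an explicit element [k_(a,b)] ([arc_meet]),
obtained from the largest element by removing just enough inversions to lose
the inversion [(a,b)]. A direct comparison of inversions gives
[w_(c,d) <= k_(a,b)] iff there is no edge [(c,d) -> (a,b)] and
[(c,d) <> (a,b)] ([arc_join_le_meet]; the relation [arc_edge] is reflexive on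
arcs, so that the second condition is built in). So it only has to be shown
that [k_(a,b)] may be replaced by the meet-irreducible [m_t] for which
[j_t = w_(a,b)].

The join-irreducibles are the [w_(a,b)]. Each [w_(a,b)] is join-irreducible
because everything strictly below it is below [k_(a,b)]
([lt_arc_join_le_meet]). That there are no others follows by counting: an
element is determined by the [w_(a,b)] below it ([tam_le_arcs]), so a chain is
no longer than the number of arcs, while a labeled maximal chain is as long as
the number of join-irreducibles ([labeling_arcs]).

To compare [k_t] with [m_t], choose a meet-irreducible [m_(sigma t)] that lies
above [k_t] but not above [j_t]. The labeling gives [j_s <= m_t] for [s < t],
hence [sigma t <= t]; antisymmetry of the edge relation makes [sigma]
injective; so [sigma] is the identity and [k_t <= m_t]
([labeling_meet_unique]). This yields one inclusion of edge sets. For the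
other, an edge [(c,d) -> (a,b)] forces every upper bound of [w_(c,d)] and
[k_(a,b)] to be above [w_(a,b)] ([arc_edge_join_le]), whereas [m_t] is above
[k_t] and not above [j_t]. *)

(** * Permutations that sort positions lexicographically *)

Section LexSort.
Variable n : nat.
Implicit Types (t r : 'I_n -> nat) (w : 'S_n) (i k : 'I_n).

(** The key [r] is compared in reverse, because elements high in Tam list the
regions from right to left. *)
Definition lex t r i k : bool :=
  (t i < t k) || (t i == t k) && ((r k < r i) || (r i == r k) && (i < k)).

Definition lex_perm t r : 'S_n :=
  odflt 1%g [pick w : 'S_n | [forall i, forall k, (w i < w k) == lex t r i k]].

Lemma lex_permE t r i k : (lex_perm t r i < lex_perm t r k) = lex t r i k.
Proof.
rewrite /lex_perm; case: pickP => [w /forallP/(_ i)/forallP/(_ k)/eqP // | no_w].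
(* The value at a position is the number of positions preceding it in [lex]. *)
have rank_lt l : #|[set h | lex t r h l]| < n.
  rewrite -[X in _ < X]card_ord; apply: proper_card; rewrite properE subset_predT.
  by apply/subsetPn; exists l; rewrite // inE /lex; lia.
pose rank l := Ordinal (rank_lt l).
have rank_homo l h : lex t r l h -> rank l < rank h.
  move=> lt_lh; apply: proper_card; rewrite properE; apply/andP; split.
    by apply/subsetP=> q; rewrite !inE; move: lt_lh; rewrite /lex; lia.
  by apply/subsetPn; exists l; rewrite ?inE // /lex; lia.
have lex_total l h : l != h -> lex t r l h || lex t r h l.
  by rewrite -val_eqE /lex /=; lia.
have rank_inj : injective rank.
  move=> l h eq_lh; apply/eqP/negPn/negP=> /lex_total.
  by case/orP=> /rank_homo; rewrite eq_lh ltnn.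
case/negP: (no_w (perm rank_inj)).
apply/forallP=> l; apply/forallP=> h; rewrite !permE; apply/eqP; apply/idP/idP.
  move=> lt_lh; have [eq_lh | ne_lh] := eqVneq l h; first by rewrite eq_lh ltnn in lt_lh.
  by case/orP: (lex_total _ _ ne_lh) => // /rank_homo /(ltn_trans lt_lh); rewrite ltnn.
exact: rank_homo.
Qed.

End LexSort.

(** * Regions and membership in Tam *)

(** The index of a region as the number of cut points to the left: this makes
it monotone by construction, and turns the condition that defines [S_alpha]
into a comparison of consecutive indices. *)
Definition region (alpha : seq nat) (i : nat) : nat :=
  count (fun c => c <= i) [seq psum alpha k | k <- iota 1 (size alpha).-1].

Section Regions.
Variables (n : nat) (alpha : seq nat).
Hypothesis sum_alpha : sumn alpha = n.
Local Notation reg := (region alpha).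

Lemma leq_region i k : i <= k -> reg i <= reg k.
Proof. by move=> le_ik; apply: sub_count => c /leq_trans; apply. Qed.

Lemma regionS i : (reg i == reg i.+1) =
  (i.+1 \notin [seq psum alpha k | k <- iota 1 (size alpha).-1]).
Proof.
rewrite /region; set s := map _ _.
have -> : count (leq^~ i.+1) s = count (leq^~ i) s + count_mem i.+1 s.
  by elim: s => //= c s ->; lia.
by rewrite -has_pred1 has_count; lia.
Qed.

Lemma leq_psum k l : k <= l -> psum alpha k <= psum alpha l.
Proof.
by move=> le_kl; rewrite /psum -(subnKC le_kl) takeD sumn_cat leq_addr.
Qed.

Lemma in_region_region k i : k < size alpha -> in_region alpha k i -> reg i = k.
Proof.
move=> lt_k /andP[le_i lt_i]; rewrite /region count_map.
have [p eq_p] : exists p, (size alpha).-1 = k + p by exists ((size alpha).-1 - k); lia.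
rewrite eq_p iotaD count_cat.
rewrite (@eq_in_count _ _ predT) => [|l]; last first.
  by rewrite mem_iota /= => /andP[_ lt_l]; apply: leq_trans le_i; apply: leq_psum; lia.
rewrite count_predT size_iota (@eq_in_count _ _ pred0) ?count_pred0 ?addn0 // => l.
rewrite mem_iota /= => /andP[le_l _]; apply/negbTE; rewrite -ltnNge.
by apply: (leq_trans lt_i); apply: leq_psum; lia.
Qed.

Lemma same_regionE (i k : 'I_n) : same_region alpha i k = (reg i == reg k).
Proof.
have ex_reg (l : 'I_n) : exists2 h : 'I_(size alpha), in_region alpha h l & reg l = h.
  have ex_h : exists h, l < psum alpha h.
    by exists (size alpha); rewrite /psum take_size sum_alpha.
  case: (ex_minnP ex_h) => [[|h]]; first by rewrite /psum take0.
  move=> lt_l min_h.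
  have lt_h : h < size alpha.
    by apply: min_h; rewrite /psum take_size sum_alpha.
  have in_h : in_region alpha h l.
    rewrite /in_region lt_l andbT leqNgt; apply/negP=> /min_h; lia.
  by exists (Ordinal lt_h) => //; apply: in_region_region.
apply/existsP/eqP => [[h /andP[]] | ].
  by move=> /(in_region_region (ltn_ord h)) -> /(in_region_region (ltn_ord h)) ->.
have [h in_h ->] := ex_reg i; have [h' in_h' ->] := ex_reg k.
by move=> /val_inj eq_h; exists h; rewrite in_h eq_h.
Qed.

(** An ascent between neighbours within every region propagates to the whole
region, since by monotonicity the positions between two positions of a region
belong to it. *)
Lemma mem_S_alpha (w : 'S_n) :
  reflect (forall i k : 'I_n, i < k -> reg i = reg k -> w i < w k)
          (w \in S_alpha n alpha).
Proof.
rewrite inE; apply: (iffP forallP) => [incr_w i k lt_ik | incr_w i]; last first.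
  apply/forallP=> k; apply/implyP=> /andP[/eqP eq_k]; rewrite /= eq_k -regionS => /eqP eq_r.
  by apply: incr_w; rewrite ?eq_k.
have [d eq_d] : exists d, val k = i + d.+1 by exists (k - i.+1); rewrite /=; lia.
elim: d k eq_d {lt_ik} => [|d IHd] k eq_k eq_r.
  have /forallP/(_ k)/implyP := incr_w i; apply.
  have eq_k' : k = i.+1 :> nat by rewrite /= in eq_k; lia.
  by rewrite /= eq_k' eqxx /= -regionS eq_r eq_k'.
have lt_h : i + d.+1 < n by move: (ltn_ord k); rewrite /= in eq_k; lia.
pose h := Ordinal lt_h.
have eq_kh : k = h.+1 :> nat by rewrite /= in eq_k *; lia.
have le1 : reg i <= reg h by apply: leq_region; rewrite /=; lia.
have le2 : reg h <= reg k by apply: leq_region; lia.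
have eq_rh : reg h = reg k by lia.
apply: (@ltn_trans (w h)); first by apply: IHd => //; lia.
have /forallP/(_ k)/implyP := incr_w h; apply.
by rewrite [val k]eq_kh eq_kh eqxx -regionS -eq_kh eq_rh eqxx.
Qed.

Lemma mem_S_alpha231 (w : 'S_n) :
  reflect [/\ forall i k : 'I_n, i < k -> reg i = reg k -> w i < w k
            & forall i l k : 'I_n, reg i < reg l -> reg l < reg k ->
                w i < w l -> w i <> (w k).+1 :> nat]
          (w \in S_alpha231 n alpha).
Proof.
rewrite inE; apply: (iffP andP) => [[/mem_S_alpha incr_w no231] | [incr_w no231]].
  split=> // i l k lt_il lt_lk w_il w_ik; case/negP: no231.
  apply/existsP; exists i; apply/existsP; exists l; apply/existsP; exists k.
  rewrite /pattern231 !same_regionE w_ik eqxx -w_ik w_il.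
  have lt_reg (h q : 'I_n) : reg h < reg q -> h < q.
    by rewrite !ltnNge; apply: contra; apply: leq_region.
  by rewrite !lt_reg //=; lia.
split; first exact/mem_S_alpha.
apply/negP=> /existsP[i /existsP[l /existsP[k]]]; rewrite /pattern231 !same_regionE.
case/and5P=> /ltnW/leq_region le_il /ltnW/leq_region le_lk ne_il ne_ik.
case/and4P=> ne_lk _ w_il /eqP; apply: (no231 _ l) => //; lia.
Qed.

Lemma one_S_alpha231 : 1%g \in S_alpha231 n alpha.
Proof.
apply/mem_S_alpha231; split=> [i k | i l k] lt1 lt2; rewrite !perm1 // => _ eq_ik.
have /leq_region : k <= i by lia.
lia.
Qed.
(** The default value of the partial constructions below. *)
Definition tam_one : Tam n alpha := MkTam one_S_alpha231.

Lemma tam_incr (x : Tam n alpha) (i k : 'I_n) :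
  i <= k -> reg i = reg k -> x i <= x k.
Proof.
rewrite leq_eqVlt => /predU1P[/val_inj -> // | lt_ik] eq_r.
by have /mem_S_alpha231[incr _] := tam_valP x; apply/ltnW/incr.
Qed.

Lemma tam_leP (x y : Tam n alpha) :
  reflect (forall i k : 'I_n, i < k -> x k < x i -> y k < y i) (x <= y)%O.
Proof.
apply: (iffP subsetP) => [le_xy i k lt_ik x_ik | le_xy [i k]].
  by have := le_xy (i, k); rewrite !inE /= lt_ik x_ik => /(_ isT).
by rewrite !inE /= => /andP[lt_ik /(le_xy _ _ lt_ik) ->]; rewrite lt_ik.
Qed.

Lemma tam_inv_region (x : Tam n alpha) (i k : 'I_n) :
  i < k -> x k < x i -> reg i < reg k.
Proof.
move=> lt_ik x_ik; rewrite ltn_neqAle leq_region ?andbT; last exact: ltnW.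
apply/eqP=> /(tam_incr x (ltnW lt_ik)); lia.
Qed.


Lemma region_ltn (i k : nat) : reg i < reg k -> i < k.
Proof. by rewrite !ltnNge; apply: contra; apply: leq_region. Qed.

Lemma is_arcE (a b : 'I_n) : is_arc alpha a b = (reg a < reg b).
Proof.
rewrite /is_arc same_regionE; have := @region_ltn a b.
have := @leq_region a b; lia.
Qed.

(** * The join-irreducible of an arc *)

(** A permutation with one descent [(a,b)] lists a set of positions with
maximum [b] increasingly, and then the other positions, with minimum [a].
Increase along regions and avoidance of 231 leave only one choice for the
second set, namely this one. *)
Definition upper_part (a b i : 'I_n) : bool := (a <= i) && (reg i == reg a) || (b < i).

Definition join_perm (a b : 'I_n) : 'S_n := lex_perm (upper_part a b) (fun=> 0).

Lemma join_permE a b i k : (join_perm a b i < join_perm a b k) =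
  (upper_part a b i < upper_part a b k) || (upper_part a b i == upper_part a b k) && (i < k).
Proof. by rewrite lex_permE /lex; lia. Qed.

Lemma join_perm_tam a b : is_arc alpha a b -> join_perm a b \in S_alpha231 n alpha.
Proof.
rewrite is_arcE => lt_ab; apply/mem_S_alpha231; split.
  move=> i k lt_ik eq_r; rewrite join_permE /upper_part.
  have := @leq_region i b; have := @leq_region b i.
  have := @leq_region k b; have := @leq_region b k.
  lia.
move=> i l k lt_il lt_lk w_il w_ik.
have w_ki : join_perm a b k < join_perm a b i by rewrite w_ik.
have := region_ltn lt_il; have := region_ltn lt_lk.
move: w_il w_ki; rewrite !join_permE /upper_part; lia.
Qed.

Definition arc_join (a b : 'I_n) : Tam n alpha := insubd tam_one (join_perm a b).

Lemma val_arc_join a b : is_arc alpha a b -> arc_join a b = join_perm a b :> 'S_n.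
Proof. by move=> /join_perm_tam ab; apply: (insubdK tam_one ab). Qed.

Lemma Inv_join_perm a b (i k : 'I_n) : is_arc alpha a b -> i < k ->
  (join_perm a b k < join_perm a b i) = [&& reg i == reg a, a <= i, reg a < reg k & k <= b].
Proof.
rewrite is_arcE => lt_ab lt_ik; rewrite join_permE /upper_part.
have := @leq_region i k; have := @leq_region a k; lia.
Qed.

Lemma arc_join_leP (a b : 'I_n) (x : Tam n alpha) : is_arc alpha a b ->
  reflect (forall k : 'I_n, reg a < reg k -> k <= b -> x k < x a) (arc_join a b <= x)%O.
Proof.
move=> ab; apply: (iffP (tam_leP _ _)); rewrite val_arc_join //.
  move=> le_wx k lt_ak le_kb.
  have lt_ak' := region_ltn lt_ak.
  by apply: le_wx => //; rewrite Inv_join_perm // eqxx leqnn lt_ak.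
move=> le_x i k lt_ik; rewrite Inv_join_perm // => /and4P[/eqP eq_r le_ai lt_ak le_kb].
by apply: leq_trans (le_x k lt_ak le_kb) _; apply: tam_incr.
Qed.

Lemma Des_arc_join a b : is_arc alpha a b -> Des (arc_join a b) = [set (a, b)].
Proof.
move=> ab; have lt_r := ab; rewrite is_arcE in lt_r; rewrite val_arc_join //.
have w_ba : join_perm a b b < join_perm a b a.
  by rewrite Inv_join_perm // ?eqxx ?leqnn ?lt_r //; apply: region_ltn.
apply/setP=> -[i k]; rewrite !inE xpair_eqE /=; apply/idP/idP.
  case/andP=> lt_ik /eqP w_ik.
  have : join_perm a b k < join_perm a b i by rewrite w_ik.
  rewrite Inv_join_perm // => /and4P[/eqP eq_r le_ai lt_ak le_kb].
  have w_ai : join_perm a b a <= join_perm a b i.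
    rewrite leqNgt join_permE /upper_part; lia.
  have w_kb : join_perm a b k <= join_perm a b b.
    rewrite leqNgt join_permE /upper_part; lia.
  apply/andP; split; apply/eqP/(@perm_inj _ (join_perm a b))/val_inj => /=; lia.
case/andP=> /eqP-> /eqP->; rewrite (region_ltn lt_r) /=.
have lt_v : (join_perm a b b).+1 < n by apply: leq_ltn_trans w_ba _.
pose q := ((join_perm a b)^-1)%g (Ordinal lt_v).
have w_q : join_perm a b q = (join_perm a b b).+1 :> nat by rewrite permKV.
have le_aq : join_perm a b a <= join_perm a b q.
  rewrite leqNgt; apply/negP=> w_qa.
  have : join_perm a b b < join_perm a b q by rewrite w_q.
  by have := region_ltn lt_r; move: w_qa; rewrite !join_permE /upper_part; lia.
lia.
Qed.

Lemma arc_join_inj a b a' b' : is_arc alpha a b -> is_arc alpha a' b' ->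
  arc_join a b = arc_join a' b' -> (a, b) = (a', b').
Proof.
move=> ab ab' eq_w; apply/eqP; rewrite -in_set1 -Des_arc_join // -eq_w.
by rewrite Des_arc_join // set11.
Qed.

(** Apart from positions in the region of [b], where [x] increases, a position
[k] that violates [arc_join_leP] would form a pattern [(a,k,b)]. *)
Lemma descent_arc_join (a b : 'I_n) (x : Tam n alpha) : a < b -> x a = (x b).+1 :> nat ->
  is_arc alpha a b && (arc_join a b <= x)%O.
Proof.
move=> lt_ab x_ab.
have ab : is_arc alpha a b by rewrite is_arcE (@tam_inv_region x) ?x_ab.
rewrite ab; apply/arc_join_leP => // k lt_ak le_kb.
have /mem_S_alpha231[_ no231] := tam_valP x.
have ne_x : x k != x a :> nat.
  rewrite (inj_eq val_inj) (inj_eq perm_inj); apply: contraTneq lt_ak => ->; lia.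
have := leq_region le_kb; rewrite leq_eqVlt => /predU1P[eq_r | lt_kb].
  by have := tam_incr x le_kb eq_r; lia.
have := no231 a k b lt_ak lt_kb; lia.
Qed.

(** Induction on [x i - x k] for an inversion [(i,k)] of [x]. An intermediate
value at an intermediate position splits the inversion. Otherwise all
intermediate values lie left of [i] or right of [k], and where they first pass
from right to left there is a descent [(a,b)] with [a <= i < k <= b]. Then
[w_(a,b) <= x] forces [a] and [i] into the same region, and [w_(a,b) <= y] gives
[y k < y a <= y i]. *)
Lemma tam_le_arcs (x y : Tam n alpha) :
  (forall a b, is_arc alpha a b -> (arc_join a b <= x)%O -> (arc_join a b <= y)%O) ->
  (x <= y)%O.
Proof.
move=> le_arcs; apply/tam_leP => i k.
have [d] := ubnP (x i - x k); elim: d i k => // d IHd i k le_d lt_ik x_ik.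
have lt_r := tam_inv_region lt_ik x_ik.
case: (pickP (fun q : 'I_n => [&& i < q, q < k, x k < x q & x q < x i])) => [q | no_q].
  case/and4P=> lt_iq lt_qk x_kq x_qi.
  by apply: (@ltn_trans (y q)); apply: IHd => //; lia.
have Pi : (i <= i) && (x k < x i) by rewrite leqnn.
case: (@arg_minnP _ i (fun q => (q <= i) && (x k < x q)) (fun q => x q) Pi) => a.
case/andP=> le_ai x_ka min_a.
have lt_v : (x a).-1 < n by move: (ltn_ord (x a)); lia.
pose b := ((tam_val x)^-1)%g (Ordinal lt_v).
have x_ab : x a = (x b).+1 :> nat by rewrite permKV /=; lia.
have x_ai : x a <= x i by apply: min_a.
have le_kb : k <= b.
  rewrite leqNgt; apply/negP=> lt_bk.
  have ne_x : x k != x b :> nat.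
    by rewrite (inj_eq val_inj) (inj_eq perm_inj); apply: contraTneq lt_bk => ->; lia.
  have := no_q b; have := min_a b; lia.
have lt_ab : a < b by lia.
have /andP[ab le_x] := descent_arc_join lt_ab x_ab.
have /(arc_join_leP _ ab) y_a := le_arcs a b ab le_x.
have /(arc_join_leP _ ab) x_a := le_x.
have eq_r : reg a = reg i.
  apply/eqP; rewrite eqn_leq leq_region //= leqNgt; apply/negP=> /x_a; lia.
by apply: leq_trans (tam_incr y le_ai eq_r); apply: y_a; rewrite ?eq_r.
Qed.

(** * The meet-irreducible partner of an arc *)

Definition first_in_region (b : 'I_n) : bool := [forall q : 'I_n, (q < b) ==> (reg q < reg b)].

(** The permutation [meet_perm] sorts by tier, then by decreasing region. Sorting
by decreasing region alone gives the largest element of Tam. Putting [b] and the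
later positions of its region in tier 1 lifts them above [a] and above the
regions in between; what lies above [a] anyway, namely the earlier regions and
the rest of the region of [a], goes to tier 2. If [b] starts its region, then
the regions after that of [b] have to be lifted as well: otherwise one of them
and one of the regions before [b] would contain consecutive values, with the
lifted region of [b] between them, which is a 231-pattern. *)
Definition tier (a b i : 'I_n) : nat :=
  2 * ((reg i < reg a) || (reg i == reg a) && (a < i))
  + (b <= i) && ((reg i == reg b) || first_in_region b).

Definition meet_perm (a b : 'I_n) : 'S_n := lex_perm (tier a b) (fun i => reg i).

Lemma meet_permE a b i k : (meet_perm a b i < meet_perm a b k) =
  lex (tier a b) (fun i => reg i) i k.
Proof. exact: lex_permE. Qed.

Lemma tier_region_ltn a b (i k : 'I_n) : is_arc alpha a b -> reg i < reg k ->
  (tier a b i < tier a b k) =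
  [&& (reg a < reg i) || (reg i == reg a) && (i <= a),
    reg i < reg b, b <= k & (reg k == reg b) || first_in_region b].
Proof.
rewrite is_arcE => lt_ab lt_ik; rewrite /tier.
have lt_ik' := region_ltn lt_ik.
have := @leq_region b i; have := @leq_region b k; have := region_ltn lt_ab.
have : first_in_region b -> i < b -> reg i < reg b by move/forallP/(_ i)/implyP.
case: first_in_region; lia.
Qed.

Lemma meet_perm_tam a b : is_arc alpha a b -> meet_perm a b \in S_alpha231 n alpha.
Proof.
move=> ab; have lt_r := ab; rewrite is_arcE in lt_r.
apply/mem_S_alpha231; split=> [i k lt_ik eq_r | i l k lt_il lt_lk w_il w_ik].
  rewrite meet_permE /lex /tier; case: first_in_region; lia.
have : tier a b i < tier a b l by move: w_il; rewrite meet_permE /lex; lia.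
rewrite tier_region_ltn // => /and4P[ge_ai lt_ib le_bl r_l].
have w_ki : meet_perm a b k < meet_perm a b i by rewrite w_ik.
(* If [b] started its region, then [k] would be lifted together with [l]. So there
   is a position [q] before [b] in that region, and its value lies strictly
   between those of [k] and [i]. *)
have lt_il' := region_ltn lt_il; have lt_lk' := region_ltn lt_lk.
have lt_ib' := region_ltn lt_ib; have lt_ab' := region_ltn lt_r.
have not_first: ~~ first_in_region b.
  apply/negP=> first_b; move: w_ki; rewrite meet_permE /lex /tier first_b; lia.
have := not_first; rewrite negb_forall => /existsP[q].
rewrite negb_imply => /andP[lt_qb r_q].
have eq_q : reg q = reg b by have := leq_region (ltnW lt_qb); lia.
have w_kq : meet_perm a b k < meet_perm a b q.
  rewrite meet_permE /lex /tier; move: r_l; rewrite (negbTE not_first); lia.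
have : meet_perm a b q < meet_perm a b i.
  rewrite meet_permE /lex /tier; move: r_l; rewrite (negbTE not_first); lia.
lia.
Qed.

Definition arc_meet (a b : 'I_n) : Tam n alpha := insubd tam_one (meet_perm a b).

Lemma Inv_arc_meet a b (i k : 'I_n) : is_arc alpha a b -> reg i < reg k ->
  (arc_meet a b k < arc_meet a b i) = ~~ (tier a b i < tier a b k).
Proof.
move=> ab lt_ik; have -> : arc_meet a b = meet_perm a b :> 'S_n.
  exact: (insubdK tam_one (meet_perm_tam ab)).
by rewrite meet_permE /lex; lia.
Qed.

(** * Joins and partners compared *)

(** A failure [c, q] of [arc_join_leP] is a pair on which sorting by tier
overrules sorting by region; as [q] is then weakly right of [b], such a [q <= d]
exists iff [q = b] is one. *)
Lemma arc_join_le_meet a b c d : is_arc alpha a b -> is_arc alpha c d ->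
  (arc_join c d <= arc_meet a b)%O = ~~ arc_edge alpha c d a b.
Proof.
move=> ab cd; have := ab; have := cd; rewrite !is_arcE => lt_cd lt_ab.
have lt_ab' := region_ltn lt_ab.
rewrite /arc_edge !same_regionE; apply/(arc_join_leP _ cd)/idP => [le_cd | no_edge q lt_cq le_qd].
  apply/negP=> edge_cd.
  have lt_cb : reg c < reg b by have := @leq_region c b; lia.
  have := le_cd b lt_cb; rewrite Inv_arc_meet // tier_region_ltn //.
  by have := @leq_region a c; lia.
rewrite Inv_arc_meet // tier_region_ltn //; apply: contra no_edge => /and4P[ge_ac lt_cb le_bq _].
by have := region_ltn lt_cb; have := @region_ltn a c; lia.
Qed.

Lemma arc_edge_refl (a b : 'I_n) : is_arc alpha a b -> arc_edge alpha a b a b.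
Proof. by rewrite is_arcE /arc_edge same_regionE => /region_ltn ->; rewrite eqxx !leqnn. Qed.

Lemma arc_edge_anti (a b a' b' : 'I_n) :
  arc_edge alpha a b a' b' -> arc_edge alpha a' b' a b -> (a, b) = (a', b').
Proof.
rewrite /arc_edge !same_regionE => e1 e2.
have [eq_a eq_b] : a = a' :> nat /\ b = b' :> nat by lia.
by congr pair; apply: val_inj.
Qed.

(** The only inversion of [w_(a,b)] that [k_(a,b)] lacks is [(a,b)]. An element
below [w_(a,b)] that has this inversion has all the others: when [k < b] lies in a
region after that of [a], the pair [(k,b)] is not an inversion of [w_(a,b)], hence
not one of the element itself, whose value at [k] is thus below that at [a]. *)
Lemma lt_arc_join_le_meet a b (y : Tam n alpha) : is_arc alpha a b ->
  (y <= arc_join a b)%O -> y != arc_join a b -> (y <= arc_meet a b)%O.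
Proof.
move=> ab le_yw ne_yw; have := ab; rewrite is_arcE => lt_ab.
have Inv_y (i k : 'I_n) : i < k -> y k < y i ->
    [&& reg i == reg a, a <= i, reg a < reg k & k <= b].
  by move=> lt_ik y_ik; rewrite -Inv_join_perm // -val_arc_join //; apply: (tam_leP _ _ le_yw).
have y_ab : ~~ (y b < y a).
  apply: contra ne_yw => y_ab; apply/eqP/le_anti; rewrite le_yw /=.
  apply/arc_join_leP => // k lt_ak le_kb; apply: leq_ltn_trans y_ab.
  move: le_kb; rewrite leq_eqVlt => /predU1P[/val_inj -> // | lt_kb].
  by rewrite leqNgt; apply/negP=> /(Inv_y _ _ lt_kb); lia.
apply/tam_leP => i k lt_ik y_ik; have /and4P[/eqP eq_i le_ai lt_ak le_kb] := Inv_y _ _ lt_ik y_ik.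
rewrite Inv_arc_meet ?eq_i // tier_region_ltn ?eq_i //.
apply: contra y_ab => /and4P[le_ia _ le_bk _].
have eq_ia : i = a by apply: val_inj => /=; lia.
have eq_kb : k = b by apply: val_inj => /=; lia.
by rewrite -eq_ia -eq_kb.
Qed.

Lemma join_irreducible_arc_join a b : is_arc alpha a b -> join_irreducible (arc_join a b).
Proof.
move=> ab; have not_le : ~~ (arc_join a b <= arc_meet a b)%O.
  by rewrite arc_join_le_meet // negbK arc_edge_refl.
apply/andP; split; first by apply: contra not_le => /forallP/(_ (arc_meet a b)).
apply/forallP=> y; apply/forallP=> z; apply/implyP=> /andP[/forall_inP ub_w /forallP lub_w].
apply: contraR not_le; rewrite negb_or => /andP[ne_y ne_z].
apply: (implyP (lub_w _)); apply/forall_inP=> x; rewrite !inE => /orP[]/eqP->.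
  by apply: lt_arc_join_le_meet; rewrite // 1?eq_sym // ub_w // !inE eqxx.
by apply: lt_arc_join_le_meet; rewrite // 1?eq_sym // ub_w // !inE eqxx orbT.
Qed.

(** If [a] and [c] share a region then [w_(a,b) <= w_(c,d)]. Otherwise
[k_(a,b)] has every inversion of [w_(a,b)] except [(a,b)], which arises by
transitivity from [(a,c)] in [k_(a,b)] and [(c,b)] in [w_(c,d)]. *)
Lemma arc_edge_join_le a b c d (y : Tam n alpha) :
  is_arc alpha a b -> is_arc alpha c d -> arc_edge alpha c d a b ->
  (arc_join c d <= y)%O -> (arc_meet a b <= y)%O -> (arc_join a b <= y)%O.
Proof.
move=> ab cd edge_cd /(arc_join_leP _ cd) y_c le_ky.
have := ab; rewrite is_arcE => lt_ab; have := edge_cd; rewrite /arc_edge !same_regionE.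
case/orP=> [/and4P[/eqP eq_r le_ca _ le_bd] | /and5P[ne_ca lt_ac lt_cb le_bd ne_cb]].
  apply/arc_join_leP => // k lt_ak le_kb.
  apply: leq_trans (tam_incr y le_ca eq_r); apply: y_c; rewrite ?eq_r //.
  exact: leq_trans le_bd.
have lt_rac : reg a < reg c by have := leq_region (ltnW lt_ac); lia.
have lt_rcb : reg c < reg b by have := leq_region (ltnW lt_cb); lia.
have y_a (k : 'I_n) : reg a < reg k -> k < b -> y k < y a.
  move=> lt_ak lt_kb; apply: (tam_leP _ _ le_ky); first exact: region_ltn.
  by rewrite Inv_arc_meet // tier_region_ltn //; lia.
apply/arc_join_leP => // k lt_ak; rewrite leq_eqVlt => /predU1P[/val_inj -> | ].
  by apply: ltn_trans (y_a c lt_rac lt_cb); apply: y_c.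
exact: y_a.
Qed.

End Regions.

(** * Galois labelings of finite posets *)

Section GaloisLabelings.
Local Open Scope order_scope.
Variables (d : Order.disp_t) (L : finPOrderType d).
Implicit Types x y : L.

(** A maximal element among those above [x] and not above [y] is
meet-irreducible: everything strictly above it is above [y], and so is any
greatest lower bound of two such elements. *)
Lemma meet_irreducible_separation x y : ~~ (y <= x) ->
  exists z, [&& meet_irreducible z, x <= z & ~~ (y <= z)].
Proof.
move=> not_yx; have Px : (x <= x) && ~~ (y <= x) by rewrite lexx.
case: (@arg_maxnP _ x (fun z => (x <= z) && ~~ (y <= z))
         (fun z => #|[set u | u <= z]|) Px) => z /andP[le_xz not_yz] max_z.
have above_z u : z <= u -> z != u -> y <= u.
  move=> le_zu ne_zu; apply/negPn/negP=> not_yu.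
  have : (#|[set v : L | (v <= u)%O]| <= #|[set v : L | (v <= z)%O]|)%N.
    by apply: max_z; rewrite (le_trans le_xz).
  rewrite leqNgt => /negP; case; apply: proper_card; rewrite properE; apply/andP; split.
    by apply/subsetP=> v; rewrite !inE => /le_trans; apply.
  apply/subsetPn; exists u; rewrite !inE ?lexx //.
  by apply: contra ne_zu => le_uz; rewrite eq_le le_zu.
exists z; rewrite le_xz not_yz andbT andbT; apply/andP; split.
  by apply: contra not_yz => /forallP; apply.
apply/forallP=> p; apply/forallP=> q; apply/implyP=> /andP[/forall_inP lb_z /forallP glb_z].
apply: contraR not_yz; rewrite negb_or => /andP[ne_p ne_q].
apply: (implyP (glb_z _)); apply/forall_inP=> u; rewrite !inE => /orP[]/eqP->.
  by rewrite above_z // lb_z // !inE eqxx.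
by rewrite above_z // lb_z // !inE eqxx orbT.
Qed.

Variables (a : 'I_(poset_length L).+1 -> L) (j m : 'I_(poset_length L) -> L).
Hypothesis ajmP : galois_labeling a j m.

(** The element [a t] of the chain separates the two. *)
Lemma labeling_join_le_meet (s t : 'I_(poset_length L)) : (s < t)%N -> j s <= m t.
Proof.
move=> lt_st; pose t' := widen_ord (leqnSn _) t.
apply: (@le_trans _ _ (a t')).
  have /andP[/forall_inP ub_a _] := chain_joins ajmP t'.
  by apply: ub_a; apply/imsetP; exists s; rewrite ?inE.
have /andP[/forall_inP lb_a _] := chain_meets ajmP t'.
by apply: lb_a; apply/imsetP; exists t; rewrite ?inE /=.
Qed.

(** The matching of [j t] with [m t] is the only one that pairs each
join-irreducible with a meet-irreducible not above it, since the relation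
[~~ (j s <= m t)] is triangular. Any family [k] whose relation to [j] is
reflexive and antisymmetric yields such a matching, and is thereby located below [m]. *)
Lemma labeling_meet_unique (k : 'I_(poset_length L) -> L) :
    (forall t, ~~ (j t <= k t)) ->
    (forall s t, ~~ (j s <= k t) -> ~~ (j t <= k s) -> s = t) ->
  forall t, (k t <= m t) && ~~ (j t <= m t).
Proof.
move=> not_jk anti_jk.
have /fin_all_exists[sigma sigmaP] t : exists i, (k t <= m i) && ~~ (j t <= m i).
  have [z /and3P[/(m_image ajmP)[i ->] le_kz not_jz]] := meet_irreducible_separation (not_jk t).
  by exists i; rewrite le_kz.
have sigma_le t : (sigma t <= t)%N.
  have /andP[_] := sigmaP t; rewrite leqNgt; apply: contra; exact: labeling_join_le_meet.
have sigma_inj : injective sigma.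
  move=> s t eq_st; have /andP[le_s not_s] := sigmaP s; have /andP[le_t not_t] := sigmaP t.
  apply: anti_jk; [move: not_s; rewrite eq_st | move: not_t; rewrite -eq_st];
    by apply: contra => /le_trans; apply.
suff sigma_id t : sigma t = t by move=> t; have := sigmaP t; rewrite sigma_id.
have [p] := ubnP t; elim: p t => // p IHp t le_tp.
have := sigma_le t; rewrite leq_eqVlt => /predU1P[/val_inj // | lt_t].
apply: sigma_inj; apply: IHp; exact: leq_trans lt_t _.
Qed.

(** The chain of the labeling has one step for each join-irreducible, so that a
strictly increasing [f] bounds their number. *)
Lemma labeling_length_le (f : L -> nat) (N : nat) :
  (forall x y, x < y -> (f x < f y)%N) -> (forall x, f x <= N)%N -> (poset_length L <= N)%N.
Proof.
move=> f_incr f_le; apply: leq_trans (f_le (a ord_max)).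
suff le_f s (lt_s : (s < (poset_length L).+1)%N) : (s <= f (a (Ordinal lt_s)))%N.
  by have := le_f _ (ltnSn _); congr (_ <= f (a _))%N; apply: val_inj.
elim: s lt_s => // s IHs lt_s.
have /andP[lt_a _] := @chain_covers _ _ _ _ _ ajmP (Ordinal (ltnW lt_s)) (Ordinal lt_s) erefl.
exact: leq_ltn_trans (IHs _) (f_incr _ _ lt_a).
Qed.

End GaloisLabelings.

(** * Galois labelings of Tam *)

Section TamLabeling.
Variables (n : nat) (alpha : seq nat) (sum_alpha : sumn alpha = n).
Variables (a : 'I_(poset_length (Tam n alpha)).+1 -> Tam n alpha)
    (j m : 'I_(poset_length (Tam n alpha)) -> Tam n alpha).
Hypothesis ajmP : galois_labeling a j m.

Lemma labeling_arcs : exists2 arc : 'I_(poset_length (Tam n alpha)) -> 'I_n * 'I_n,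
  forall s, is_arc alpha (arc s).1 (arc s).2
  & forall s, j s = arc_join sum_alpha (arc s).1 (arc s).2.
Proof.
pose arcs := [set p : 'I_n * 'I_n | is_arc alpha p.1 p.2].
pose w (p : 'I_n * 'I_n) := arc_join sum_alpha p.1 p.2.
have w_inj : {in arcs &, injective w}.
  move=> [b c] [b' c']; rewrite !inE /= => bc bc'; exact: arc_join_inj.
have le_arcs : poset_length (Tam n alpha) <= #|arcs|.
  pose below x := [set p in arcs | (w p <= x)%O].
  apply: (labeling_length_le ajmP (f := fun x => #|below x|)) => [x y lt_xy | x].
    apply: proper_card; rewrite properE; apply/andP; split.
      by apply/subsetP=> p; rewrite !inE => /andP[-> /le_trans->] //; apply: ltW.
    apply/negP=> /subsetP le_yx.
    have : (y <= x)%O.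
      apply: (tam_le_arcs (sum_alpha := sum_alpha)) => b c bc le_y.
      by have := le_yx (b, c); rewrite !inE /= bc le_y => /(_ isT).
    by rewrite lt_geF.
  by apply: subset_leq_card; apply/subsetP=> p; rewrite inE => /andP[].
have sub_w : w @: arcs \subset j @: setT.
  apply/subsetP=> x /imsetP[p]; rewrite inE => /(join_irreducible_arc_join sum_alpha) p_JI ->.
  by have /(j_image ajmP)[s eq_s] := p_JI; apply/imsetP; exists s.
have eq_w : w @: arcs = j @: setT.
  apply/eqP; rewrite eqEcard sub_w card_imset ?cardsT ?card_ord ?card_in_imset //.
  exact: j_injective ajmP.
have /fin_all_exists2[arc] s : exists2 p, is_arc alpha p.1 p.2 & j s = w p.
  have : j s \in w @: arcs by rewrite eq_w imset_f.
  by case/imsetP=> p; rewrite inE; exists p.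
by exists arc.
Qed.

Lemma galois_graph_arcs (arc : 'I_(poset_length (Tam n alpha)) -> 'I_n * 'I_n) :
    (forall s, is_arc alpha (arc s).1 (arc s).2) ->
    (forall s, j s = arc_join sum_alpha (arc s).1 (arc s).2) ->
  forall s t, galois_graph j m s t =
    (s != t) && arc_edge alpha (arc s).1 (arc s).2 (arc t).1 (arc t).2.
Proof.
move=> arcP jE; pose k t := arc_meet sum_alpha (arc t).1 (arc t).2.
have jk s t : (j s <= k t)%O = ~~ arc_edge alpha (arc s).1 (arc s).2 (arc t).1 (arc t).2.
  by rewrite jE arc_join_le_meet.
have kmP : forall t, (k t <= m t)%O && ~~ (j t <= m t)%O.
  apply: (labeling_meet_unique ajmP) => [t | s t].
    by rewrite jk negbK arc_edge_refl.
  rewrite !jk !negbK => e1 e2; apply: (j_injective ajmP); rewrite !jE.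
  by have [-> ->] := arc_edge_anti sum_alpha e1 e2.
move=> s t; rewrite /galois_graph; congr (_ && _).
have /andP[le_km not_jm] := kmP t; apply/idP/idP => [not_s | edge_st].
  by rewrite -[arc_edge _ _ _ _ _]negbK -jk; apply: contra not_s => /le_trans; apply.
apply: contra not_jm; rewrite !jE => le_s.
exact: arc_edge_join_le edge_st le_s le_km.
Qed.

End TamLabeling.

Theorem theorem1p3 (n : nat) (alpha : seq nat) (n_gt0 : 0 < n)
    (alphaP : is_composition n alpha)
    (a : 'I_(poset_length (Tam n alpha)).+1 -> Tam n alpha)
    (j m : 'I_(poset_length (Tam n alpha)) -> Tam n alpha)
    (ajmP : galois_labeling a j m) :
  digraph_iso (galois_graph j m) (tam_digraph n alpha).
Proof.
have /andP[/eqP sum_alpha _] := alphaP.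
have [arc arcP jE] := labeling_arcs sum_alpha ajmP.
have j_JI s : join_irreducible (j s) by apply/(j_image ajmP); exists s.
pose f s : tam_JI n alpha := exist _ (j s) (j_JI s).
have f_inj : injective f by move=> s t [/(j_injective ajmP)].
exists f => [|s t].
  have /fin_all_exists[g fg] (u : tam_JI n alpha) : exists s, f s = u.
    by have /(j_image ajmP)[s eq_s] := valP u; exists s; apply: val_inj.
  by exists g => // s; apply: f_inj; rewrite fg.
rewrite (galois_graph_arcs ajmP arcP jE) /tam_digraph (inj_eq f_inj); congr (_ && _).
have Des_j i : Des (j i) = [set (arc i)].
  by rewrite jE Des_arc_join //; case: (arc i).
rewrite /= !Des_j; apply/idP/idP => [|edge_st].
  case/existsP=> b /existsP[c /existsP[b' /existsP[c' /and5P[_ _]]]].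
  by do 2![rewrite eqEsubset sub1set => /andP[/set1P-> _]].
apply/existsP; exists (arc s).1; apply/existsP; exists (arc s).2.
apply/existsP; exists (arc t).1; apply/existsP; exists (arc t).2.
by rewrite -!surjective_pairing !arcP !eqxx.
Qed.
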